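(* Let $k$ be a field. If $E$ is a finite fractional Brauer configuration of type S with integral f-degree (for example, if $E$ is a finite fractional Brauer configuration of type MS with integral f-degree, or if $E$ is a finite fractional Brauer graph of type S with integral f-degree), then the fractional Brauer configuration algebra $A_E$ is a finite-dimensional symmetric $k$-algebra.
   Context: Fractional Brauer configuration. Let $G=\langle g\rangle$ be an infinite cyclic group. A fractional Brauer configuration (f-BC) is a quadruple $E=(E,P,L,d)$, where $E$ is a $G$-set, $P$ and $L$ are two partitions of $E$ ($P(e)$ and $L(e)$ denote the classes containing $e$), and $d:E\to\mathbb{Z}_{+}$ is a function to the positive integers, such that: (f1) $L(e)\subseteq P(e)$ and $P(e)$ is finite for each $e\in E$; (f2) if $L(e_1)=L(e_2)$ then $P(g\cdot e_1)=P(g\cdot e_2)$; (f3) if $e_1,e_2$ lie in the same $\langle g\rangle$-orbit then $d(e_1)=d(e_2)$; (f4) $P(e_1)=P(e_2)$ if and only if $P(g^{d(e_1)}\cdot e_1)=P(g^{d(e_2)}\cdot e_2)$; (f5) $L(e_1)=L(e_2)$ if and only if $L(g^{d(e_1)}\cdot e_1)=L(g^{d(e_2)}\cdot e_2)$; (f6) for all $e,h\in E$ the formal sequence $L(g^{d(e)-1}\cdot e)\cdots L(g\cdot e)L(e)$ is not a proper subsequence (of consecutive terms) of the formal sequence $L(g^{d(h)-1}\cdot h)\cdots L(g\cdot h)L(h)$. $E$ is finite if the set $E$ is finite. Standard sequences. A standard sequence is $p=(g^{n-1}\cdot e,\dots,g\cdot e,e)$ with $e\in E$, $0\le n\le d(e)$;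 for $n=0$ it is the trivial sequence $()_e$; for $n=d(e)$ it is called full. Put $L(p)=L(g^{n-1}\cdot e)\cdots L(g\cdot e)L(e)$ if $n>0$ and $L(()_e)=1_{P(e)}$. Left complement: ${}^{\wedge}p=(g^{d(e)-1}\cdot e,\dots,g^{n}\cdot e)$ if $n<d(e)$ (including $n=0$), ${}^{\wedge}p=()_{g^{d(e)}\cdot e}$ if $n=d(e)$. Right complement: $p^{\wedge}=(g^{-1}\cdot e,\dots,g^{n-d(e)}\cdot e)$ if $n<d(e)$, $p^{\wedge}=()_e$ if $n=d(e)$. Write $p\equiv q$ if $L(p)=L(q)$ as formal sequences. For a set $\mathscr X$ of standard sequences, ${}^{\wedge}\mathscr X=\{{}^{\wedge}p\mid p\in\mathscr X\}$, $\mathscr X^{\wedge}=\{p^{\wedge}\mid p\in\mathscr X\}$, $[\mathscr X]=\{q \text{ standard}\mid q\equiv p\text{ for some }p\in\mathscr X\}$, and $[p]=[\{p\}]$. Types. $E$ is of type S if moreover (f7): for all standard sequences $p\equiv q$, $[[{}^{\wedge}p]^{\wedge}]=[[{}^{\wedge}q]^{\wedge}]$ or $[{}^{\wedge}[p^{\wedge}]]=[{}^{\wedge}[q^{\wedge}]]$ (these two conditions are equivalent). $E$ is of type MS if $L(e)=\{e\}$ for all $e$ (this implies type S). A fractional Brauer graph of type S is an f-BC of type S all of whose classes $P(e)$ have exactly two elements. Integral f-degree. The vertices of $E$ are its $\langle g\rangle$-orbits; the f-degree of a finite vertex $v=G\cdot e$ is $d_f(v)=d(e)/|v|$. $E$ has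 integral f-degree if $d_f(v)$ is an integer for every vertex $v$. Algebra. $Q_E$ is the quiver with vertices $P(e)$ and arrows $L(e):P(e)\to P(g\cdot e)$ ($e\in E$); paths are written right to left. $I_E$ is the ideal of the path category $kQ_E$ generated by: (fR1) $L(g^{d(e)-1-k}\cdot e)\cdots L(e)-L(g^{d(h)-1-k}\cdot h)\cdots L(h)$, where $0\le k\le\min\{d(e),d(h)\}$ is an integer, $P(e)=P(h)$ and $L(g^{d(e)-i}\cdot e)=L(g^{d(h)-i}\cdot h)$ for $1\le i\le k$; (fR2) paths $L(e_n)\cdots L(e_1)$ with $n>1$ and $\bigcap_{i=1}^n g^{n-i}\cdot L(e_i)=\emptyset$; (fR3) paths $L(g^{n-1}\cdot e)\cdots L(g\cdot e)L(e)$ with $n>d(e)$. $\Lambda_E=kQ_E/I_E$ and $A_E=\big(\bigoplus_{x,y\in (Q_E)_0}\Lambda_E(x,y)\big)^{op}$. *)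

(* Defs.v *)
From HB Require Import structures.
From mathcomp Require Import all_boot all_order all_fingroup all_algebra.
From mathcomp Require Import generic_quotient ring_quotient.
From mathcomp Require Import finmap boolp.
From mathcomp.multinomials Require Import monalg.

Set Implicit Arguments.
Unset Strict Implicit.
Unset Printing Implicit Defensive.

Import GRing.Theory Num.Theory.
Local Open Scope quotient_scope.
Local Open Scope ring_scope.

(* Unital associative k-algebras.  Unlike algType, which extends nzRingType,  *)
(* this includes the zero algebra (the algebra of the empty configuration).   *)

Record kalg (k : fieldType) := KAlg {
  kalg_sort :> lmodType k;
  kmul : kalg_sort -> kalg_sort -> kalg_sort;
  kone : kalg_sort;
  kmulA : associative kmul;
  kmul1 : left_id kone kmul;
  kmulr1 : right_id kone kmul;
  kmul_linearl : forall (c : k) (a a' b : kalg_sort),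
    kmul (c *: a + a') b = c *: kmul a b + kmul a' b;
  kmul_linearr : forall (c : k) (a b b' : kalg_sort),
    kmul a (c *: b + b') = c *: kmul a b + kmul a b' }.

Arguments kmul {k} A a b : rename.
Arguments kone {k} A : rename.

Definition oppalg (k : fieldType) (A : kalg k) : kalg k :=
  @KAlg k A (fun a b => kmul A b a) (kone A)
    (fun a b c => esym (kmulA c b a)) (@kmulr1 k A) (@kmul1 k A)
    (fun c a a' b => kmul_linearr c b a a')
    (fun c a b b' => kmul_linearl c b b' a).

(* [Vector.axiom n A] for some n, as a proposition. *)
Definition finite_dimensional (k : fieldType) (A : lmodType k) : Prop :=
  exists n (v2r : A -> 'rV[k]_n), linear v2r /\ bijective v2r.

(* A is isomorphic, as an A-A-bimodule, to its dual D(A) = Hom_k(A, k), whose *)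
(* bimodule structure is (a f b)(y) = f (b y a).                              *)
Definition symmetric_algebra (k : fieldType) (A : kalg k) : Prop :=
  let mul := kmul A in
  exists phi : A -> {scalar A},
    [/\ forall (c : k) (a b y : A), phi (c *: a + b) y = c * phi a y + phi b y,
        forall a x b y : A, phi (mul (mul a x) b) y = phi x (mul (mul b y) a),
        forall a b : A, phi a =1 phi b -> a = b
      & forall f : {scalar A}, exists a : A, phi a =1 f].

Record lincat (k : fieldType) := LinCat {
  obj : finType;
  hom : obj -> obj -> lmodType k;
  idm : forall x, hom x x;
  ccomp : forall x y z, hom y z -> hom x y -> hom x z;
  comp1m : forall x y (f : hom x y), ccomp (idm y) f = f;
  compm1 : forall x y (f : hom x y), ccomp f (idm x) = f;
  compA : forall x y z t (h : hom z t) (g : hom y z) (f : hom x y),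
    ccomp h (ccomp g f) = ccomp (ccomp h g) f;
  comp_linearl : forall x y z (f : hom x y) (c : k) (g g' : hom y z),
    ccomp (c *: g + g') f = c *: ccomp g f + ccomp g' f;
  comp_linearr : forall x y z (g : hom y z) (c : k) (f f' : hom x y),
    ccomp g (c *: f + f') = c *: ccomp g f + ccomp g f' }.

Arguments hom {k} C x y : rename.
Arguments idm {k} C x : rename.
Arguments ccomp {k} C {x y z} g f : rename.

Section LinCatTheory.
Variables (k : fieldType) (C : lincat k).

Lemma compDl x y z (g g' : hom C y z) (f : hom C x y) :
  ccomp C (g + g') f = ccomp C g f + ccomp C g' f.
Proof. by have := comp_linearl f 1 g g'; rewrite !scale1r. Qed.

Lemma compDr x y z (g : hom C y z) (f f' : hom C x y) :
  ccomp C g (f + f') = ccomp C g f + ccomp C g f'.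
Proof. by have := comp_linearr g 1 f f'; rewrite !scale1r. Qed.

Lemma comp0m x y z (f : hom C x y) : ccomp C (0 : hom C y z) f = 0.
Proof. by apply: (addIr (ccomp C (0 : hom C y z) f)); rewrite -compDl !add0r. Qed.

Lemma compm0 x y z (g : hom C y z) : ccomp C g (0 : hom C x y) = 0.
Proof. by apply: (addIr (ccomp C g (0 : hom C x y))); rewrite -compDr !add0r. Qed.

Lemma compZl x y z c (g : hom C y z) (f : hom C x y) :
  ccomp C (c *: g) f = c *: ccomp C g f.
Proof. by rewrite -[c *: g]addr0 comp_linearl comp0m addr0. Qed.

Lemma compZr x y z c (g : hom C y z) (f : hom C x y) :
  ccomp C g (c *: f) = c *: ccomp C g f.
Proof. by rewrite -[c *: f]addr0 comp_linearr compm0 addr0. Qed.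

Lemma comp_suml x y z I (r : seq I) (F : I -> hom C y z) (f : hom C x y) :
  ccomp C (\sum_(i <- r) F i) f = \sum_(i <- r) ccomp C (F i) f.
Proof.
by apply: (big_morph (fun g => ccomp C g f)); [move=> *; apply: compDl | apply: comp0m].
Qed.

Lemma comp_sumr x y z I (r : seq I) (g : hom C y z) (F : I -> hom C x y) :
  ccomp C g (\sum_(i <- r) F i) = \sum_(i <- r) ccomp C g (F i).
Proof.
by apply: (big_morph (ccomp C g)); [move=> *; apply: compDr | apply: compm0].
Qed.

End LinCatTheory.

(* The quotient of a k-linear category by the ideal generated by a family R   *)
(* of morphisms.                                                              *)

Section QuotientCategory.
Variables (k : fieldType) (C : lincat k).
Variable R : forall x y, hom C x y -> Prop.

Inductive ideal_gen : forall x y, hom C x y -> Prop :=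
| ideal_gen_rel x y (f : hom C x y) : R f -> ideal_gen f
| ideal_gen0 x y : ideal_gen (0 : hom C x y)
| ideal_gen_lin x y (c : k) (f g : hom C x y) :
    ideal_gen f -> ideal_gen g -> ideal_gen (c *: f + g)
| ideal_gen_compl x y z (h : hom C y z) (f : hom C x y) :
    ideal_gen f -> ideal_gen (ccomp C h f)
| ideal_gen_compr x y z (f : hom C y z) (h : hom C x y) :
    ideal_gen f -> ideal_gen (ccomp C f h).

Definition ideal_pred x y : pred (hom C x y) := fun f => `[< ideal_gen f >].
Arguments ideal_pred : clear implicits.

Lemma ideal_pred_zmod x y : zmod_closed (ideal_pred x y).
Proof.
split=> [|f g]; first exact/asboolP/ideal_gen0.
move=> /asboolP If /asboolP Ig; apply/asboolP.
by rewrite addrC -scaleN1r; apply: ideal_gen_lin.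
Qed.

HB.instance Definition _ x y :=
  GRing.isZmodClosed.Build (hom C x y) (ideal_pred x y) (ideal_pred_zmod x y).

Definition ideal_zmod x y : zmodClosed (hom C x y) :=
  GRing.ZmodClosed.clone _ (ideal_pred x y) _.

Definition qhom x y : Type := {ideal_quot (ideal_zmod x y)}.

HB.instance Definition _ x y := GRing.Zmodule.on (qhom x y).

Definition qpi x y (f : hom C x y) : qhom x y :=
  \pi_({ideal_quot (ideal_zmod x y)}) f.

Lemma qpiP x y (f g : hom C x y) : qpi f = qpi g <-> ideal_gen (f - g).
Proof.
split=> [/eqP|Ifg].
  by rewrite /qpi -Quotient.idealrBE => /asboolP.
by apply/eqP; rewrite /qpi -Quotient.idealrBE; apply/asboolP.
Qed.

Lemma qpi_surj x y (u : qhom x y) : exists f, u = qpi f.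
Proof. by exists (repr u); rewrite /qpi reprK. Qed.

Lemma qpiD x y (f g : hom C x y) : qpi (f + g) = qpi f + qpi g.
Proof. by rewrite /qpi !piE. Qed.

Definition qscale x y (c : k) (u : qhom x y) : qhom x y := qpi (c *: repr u).

Lemma ideal_genZ x y c (f : hom C x y) : ideal_gen f -> ideal_gen (c *: f).
Proof.
by move=> If; rewrite -[_ *: _]addr0; apply: ideal_gen_lin => //; apply: ideal_gen0.
Qed.

Lemma repr_qpi x y (f : hom C x y) : ideal_gen (repr (qpi f) - f).
Proof. by apply/qpiP; rewrite /qpi reprK. Qed.

Lemma qscaleE x y c (f : hom C x y) : qscale c (qpi f) = qpi (c *: f).
Proof. by apply/qpiP; rewrite -scalerBr; apply/ideal_genZ/repr_qpi. Qed.

Lemma qscaleA x y a b (u : qhom x y) : qscale a (qscale b u) = qscale (a * b) u.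
Proof. by have [f ->] := qpi_surj u; rewrite !qscaleE scalerA. Qed.

Lemma qscale1 x y : left_id 1 (@qscale x y).
Proof. by move=> u; have [f ->] := qpi_surj u; rewrite !qscaleE scale1r. Qed.

Lemma qscaleDr x y : right_distributive (@qscale x y) +%R.
Proof.
move=> c u v; have [f ->] := qpi_surj u; have [g ->] := qpi_surj v.
by rewrite -qpiD !qscaleE scalerDr qpiD.
Qed.

Lemma qscaleDl x y (u : qhom x y) : {morph (@qscale x y)^~ u : a b / a + b}.
Proof.
by move=> a b; have [f ->] := qpi_surj u; rewrite !qscaleE scalerDl qpiD.
Qed.

HB.instance Definition _ x y := GRing.Zmodule_isLmodule.Build k (qhom x y)
  (@qscaleA x y) (@qscale1 x y) (@qscaleDr x y) (@qscaleDl x y).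

Lemma qpiZ x y c (f : hom C x y) : qpi (c *: f) = c *: qpi f.
Proof. by rewrite -qscaleE. Qed.

Definition qcomp x y z (u : qhom y z) (v : qhom x y) : qhom x z :=
  qpi (ccomp C (repr u) (repr v)).

Lemma qcompE x y z (g : hom C y z) (f : hom C x y) :
  qcomp (qpi g) (qpi f) = qpi (ccomp C g f).
Proof.
apply/qpiP; set g' := repr _; set f' := repr _.
have -> : ccomp C g' f' - ccomp C g f
    = 1 *: ccomp C (g' - g) f' + ccomp C g (f' - f).
  rewrite scale1r compDl compDr -!scaleN1r compZl compZr !scaleN1r.
  by rewrite addrA subrK.
by apply: ideal_gen_lin; [apply: ideal_gen_compr|apply: ideal_gen_compl];
  apply: repr_qpi.
Qed.

Lemma qcomp1m x y (u : qhom x y) : qcomp (qpi (idm C y)) u = u.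
Proof. by have [f ->] := qpi_surj u; rewrite qcompE comp1m. Qed.

Lemma qcompm1 x y (u : qhom x y) : qcomp u (qpi (idm C x)) = u.
Proof. by have [f ->] := qpi_surj u; rewrite qcompE compm1. Qed.

Lemma qcompA x y z t (w : qhom z t) (v : qhom y z) (u : qhom x y) :
  qcomp w (qcomp v u) = qcomp (qcomp w v) u.
Proof.
have [f ->] := qpi_surj u; have [g ->] := qpi_surj v; have [h ->] := qpi_surj w.
by rewrite !qcompE compA.
Qed.

Lemma qcomp_linearl x y z (u : qhom x y) c (v v' : qhom y z) :
  qcomp (c *: v + v') u = c *: qcomp v u + qcomp v' u.
Proof.
have [f ->] := qpi_surj u; have [g ->] := qpi_surj v; have [g' ->] := qpi_surj v'.
by rewrite -qpiZ -qpiD !qcompE comp_linearl qpiD qpiZ.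
Qed.

Lemma qcomp_linearr x y z (v : qhom y z) c (u u' : qhom x y) :
  qcomp v (c *: u + u') = c *: qcomp v u + qcomp v u'.
Proof.
have [f ->] := qpi_surj u; have [f' ->] := qpi_surj u'; have [g ->] := qpi_surj v.
by rewrite -qpiZ -qpiD !qcompE comp_linearr qpiD qpiZ.
Qed.

Definition quotcat : lincat k :=
  @LinCat k (obj C) (fun x y => qhom x y) (fun x => qpi (idm C x)) qcomp
    qcomp1m qcompm1 qcompA qcomp_linearl qcomp_linearr.

End QuotientCategory.

(* The direct sum of all the hom spaces of C, with the multiplication induced *)
(* by composition: a is given by its components a (x, y) in C(x, y).          *)

Section CategoryAlgebra.
Variables (k : fieldType) (C : lincat k).

Definition catalg : Type :=
  {dffun forall xy : obj C * obj C, hom C xy.1 xy.2}.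

HB.instance Definition _ := Choice.on catalg.

Implicit Types a b : catalg.

Definition coef a x y : hom C x y := a (x, y).

Definition catalg_of (F : forall x y, hom C x y) : catalg :=
  [ffun xy : obj C * obj C => F xy.1 xy.2 : hom C xy.1 xy.2].

Lemma catalgE F x y : coef (catalg_of F) x y = F x y.
Proof. by rewrite /coef ffunE. Qed.

Lemma catalgP a b : (forall x y, coef a x y = coef b x y) -> a = b.
Proof. by move=> eq_ab; apply/ffunP => -[x y]; apply: eq_ab. Qed.

Definition catalg_add a b := catalg_of (fun x y => coef a x y + coef b x y).
Definition catalg_opp a := catalg_of (fun x y => - coef a x y).
Definition catalg_zero := catalg_of (fun x y => 0).

Lemma catalg_addA : associative catalg_add.
Proof. by move=> a b c; apply: catalgP => x y; rewrite !catalgE addrA. Qed.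
Lemma catalg_addC : commutative catalg_add.
Proof. by move=> a b; apply: catalgP => x y; rewrite !catalgE addrC. Qed.
Lemma catalg_add0 : left_id catalg_zero catalg_add.
Proof. by move=> a; apply: catalgP => x y; rewrite !catalgE add0r. Qed.
Lemma catalg_addN : left_inverse catalg_zero catalg_opp catalg_add.
Proof. by move=> a; apply: catalgP => x y; rewrite !catalgE addNr. Qed.

HB.instance Definition _ := GRing.isZmodule.Build catalg
  catalg_addA catalg_addC catalg_add0 catalg_addN.

Lemma catalgDE a b x y : coef (a + b) x y = coef a x y + coef b x y.
Proof. exact: catalgE. Qed.

Definition catalg_scale (c : k) a := catalg_of (fun x y => c *: coef a x y).

Lemma catalg_scaleA c d a :
  catalg_scale c (catalg_scale d a) = catalg_scale (c * d) a.
Proof. by apply: catalgP => x y; rewrite !catalgE scalerA. Qed.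
Lemma catalg_scale1 : left_id 1 catalg_scale.
Proof. by move=> a; apply: catalgP => x y; rewrite !catalgE scale1r. Qed.
Lemma catalg_scaleDr : right_distributive catalg_scale +%R.
Proof.
by move=> c a b; apply: catalgP => x y; rewrite !(catalgE, catalgDE) scalerDr.
Qed.
Lemma catalg_scaleDl a : {morph catalg_scale^~ a : c d / c + d}.
Proof.
by move=> c d; apply: catalgP => x y; rewrite !(catalgE, catalgDE) scalerDl.
Qed.

HB.instance Definition _ := GRing.Zmodule_isLmodule.Build k catalg
  catalg_scaleA catalg_scale1 catalg_scaleDr catalg_scaleDl.

Lemma catalgZE c a x y : coef (c *: a) x y = c *: coef a x y.
Proof. exact: catalgE. Qed.

Definition catalg_mul a b :=
  catalg_of (fun x z => \sum_(y : obj C) ccomp C (coef a y z) (coef b x y)).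

(* The element of C(x, y) that is the identity if x = y, and 0 otherwise.     *)
Definition catalg_unit x y : hom C x y :=
  if x =P y is ReflectT e then ecast y (hom C x y) e (idm C x) else 0.

Definition catalg_one := catalg_of catalg_unit.

Lemma catalg_unit_id x : catalg_unit x x = idm C x.
Proof. by rewrite /catalg_unit; case: eqP => // e; rewrite eq_axiomK. Qed.

Lemma catalg_unit_neq x y : x != y -> catalg_unit x y = 0.
Proof. by rewrite /catalg_unit; case: eqP. Qed.

Lemma catalg_mulA : associative catalg_mul.
Proof.
move=> a b c; apply: catalgP => x t; rewrite !catalgE.
under eq_bigr => z _ do rewrite catalgE comp_sumr.
under [RHS]eq_bigr => z _ do rewrite catalgE comp_suml.
rewrite exchange_big; apply: eq_bigr => z _; apply: eq_bigr => y _.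
by rewrite compA.
Qed.

Lemma catalg_mul1 : left_id catalg_one catalg_mul.
Proof.
move=> a; apply: catalgP => x y; rewrite catalgE (bigD1 y) //= catalgE.
rewrite catalg_unit_id comp1m big1 ?addr0 // => z ne_zy.
by rewrite catalgE catalg_unit_neq // comp0m.
Qed.

Lemma catalg_mulr1 : right_id catalg_one catalg_mul.
Proof.
move=> a; apply: catalgP => x y; rewrite catalgE (bigD1 x) //= catalgE.
rewrite catalg_unit_id compm1 big1 ?addr0 // => z ne_zx.
by rewrite catalgE catalg_unit_neq 1?eq_sym // compm0.
Qed.

Lemma catalg_mulDl : left_distributive catalg_mul +%R.
Proof.
move=> a b c; apply: catalgP => x y; rewrite catalgDE !catalgE -big_split.
by apply: eq_bigr => z _; rewrite catalgDE compDl.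
Qed.

Lemma catalg_mulDr : right_distributive catalg_mul +%R.
Proof.
move=> a b c; apply: catalgP => x y; rewrite catalgDE !catalgE -big_split.
by apply: eq_bigr => z _; rewrite catalgDE compDr.
Qed.

Lemma catalg_mulZl (c : k) a b :
  catalg_mul (c *: a) b = c *: catalg_mul a b.
Proof.
apply: catalgP => x y; rewrite catalgZE !catalgE scaler_sumr.
by apply: eq_bigr => z _; rewrite catalgZE compZl.
Qed.

Lemma catalg_mulZr (c : k) a b :
  catalg_mul a (c *: b) = c *: catalg_mul a b.
Proof.
apply: catalgP => x y; rewrite catalgZE !catalgE scaler_sumr.
by apply: eq_bigr => z _; rewrite catalgZE compZr.
Qed.

Lemma catalg_mul_linearl (c : k) a a' b :
  catalg_mul (c *: a + a') b = c *: catalg_mul a b + catalg_mul a' b.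
Proof. by rewrite catalg_mulDl catalg_mulZl. Qed.

Lemma catalg_mul_linearr (c : k) a b b' :
  catalg_mul a (c *: b + b') = c *: catalg_mul a b + catalg_mul a b'.
Proof. by rewrite catalg_mulDr catalg_mulZr. Qed.

Definition category_algebra : kalg k :=
  @KAlg k catalg catalg_mul catalg_one catalg_mulA catalg_mul1 catalg_mulr1
    catalg_mul_linearl catalg_mul_linearr.

End CategoryAlgebra.

Record quiver := Quiver {
  qvert : finType;
  qarr : finType;
  qsrc : qarr -> qvert;
  qtgt : qarr -> qvert }.

Section PathCategory.
Variables (k : fieldType) (Q : quiver).

(* The path written a_n ... a_1 (right to left) is stored in the order in     *)
(* which it is travelled, as [:: a_1; ...; a_n].                              *)
Fixpoint is_qpath (x : qvert Q) (s : seq (qarr Q)) (y : qvert Q) : bool :=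
  if s is a :: s' then (qsrc a == x) && is_qpath (qtgt a) s' y else x == y.

Lemma is_qpath_cat x y z s t :
  is_qpath x s y -> is_qpath y t z -> is_qpath x (s ++ t) z.
Proof.
elim: s x => [|a s IHs] x /=; first by move/eqP->.
by move=> /andP[-> /IHs]; apply.
Qed.

Definition qpath x y : Type := {s : seq (qarr Q) | is_qpath x s y}.

HB.instance Definition _ x y := [Choice of qpath x y by <:].

Definition qpath_id x : qpath x x := exist _ [::] (eqxx x).

Definition qpath_comp x y z (q : qpath y z) (p : qpath x y) : qpath x z :=
  exist _ (sval p ++ sval q) (is_qpath_cat (svalP p) (svalP q)).

Definition khom x y : lmodType k := {malg k[qpath x y]}.

Definition kpath x y (p : qpath x y) : khom x y := << p >>.

Definition kextend x y (V : lmodType k) (F : qpath x y -> V)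
    (f : khom x y) : V :=
  \sum_(p <- msupp f) f@_p *: F p.

Definition kcomp x y z (g : khom y z) (f : khom x y) : khom x z :=
  kextend (fun q => kextend (fun p => kpath (qpath_comp q p)) f) g.

Lemma kextendEw x y (V : lmodType k) (F : qpath x y -> V)
    (f : khom x y) (d : {fset qpath x y}) :
  (msupp f `<=` d)%fset -> kextend F f = \sum_(p <- d) f@_p *: F p.
Proof.
move=> le_fd; rewrite /kextend (big_fset_incl _ le_fd) // => p _ /mcoeff_outdom->.
by rewrite scale0r.
Qed.

Lemma kextend_linear x y (V : lmodType k) (F : qpath x y -> V) c (f g : khom x y) :
  kextend F (c *: f + g) = c *: kextend F f + kextend F g.
Proof.
pose d := (msupp (c *: f + g) `|` (msupp f `|` msupp g))%fset.
rewrite !(@kextendEw _ _ _ F _ d) ?fsubsetUl //; last 2 first.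
- by rewrite /d; apply: fsubset_trans (fsubsetUr _ _); apply: fsubsetUr.
- by rewrite /d; apply: fsubset_trans (fsubsetUr _ _); apply: fsubsetUl.
rewrite scaler_sumr -big_split; apply: eq_bigr => p _ /=.
by rewrite mcoeffD mcoeffZ scalerDl scalerA.
Qed.

Lemma kextend0 x y (V : lmodType k) (F : qpath x y -> V) : kextend F 0 = 0.
Proof. by rewrite /kextend msupp0 big_seq_fset0. Qed.

Lemma kextend_kpath x y (V : lmodType k) (F : qpath x y -> V) p :
  kextend F (kpath p) = F p.
Proof. by rewrite /kextend /kpath msuppU oner_eq0 big_seq_fset1 mcoeffUU scale1r. Qed.

Lemma kextendD x y (V : lmodType k) (F : qpath x y -> V) (f g : khom x y) :
  kextend F (f + g) = kextend F f + kextend F g.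
Proof. by have := kextend_linear F 1 f g; rewrite !scale1r. Qed.

Lemma kextendZ x y (V : lmodType k) (F : qpath x y -> V) c (f : khom x y) :
  kextend F (c *: f) = c *: kextend F f.
Proof. by have := kextend_linear F c f 0; rewrite kextend0 !addr0. Qed.

Lemma eq_kextend x y (V : lmodType k) (F G : qpath x y -> V) f :
  F =1 G -> kextend F f = kextend G f.
Proof. by move=> eqFG; apply: eq_bigr => p _; rewrite eqFG. Qed.

Lemma kextend_id x y (f : khom x y) : kextend (@kpath x y) f = f.
Proof.
rewrite [RHS]monalgE; apply: eq_bigr => p _; apply/malgP => q.
by rewrite /kpath mcoeffZ !mcoeffU mulr_natr.
Qed.

Lemma kextend_kextend x y x' y' (V : lmodType k) (F : qpath x' y' -> V)
    (G : qpath x y -> khom x' y') f :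
  kextend F (kextend G f) = kextend (fun p => kextend F (G p)) f.
Proof.
rewrite [kextend G f]/kextend [RHS]/kextend.
elim/big_rec2: _ => [|p u v _ IH]; last by rewrite kextend_linear IH.
exact: kextend0.
Qed.

Lemma qpath_comp1 x y (p : qpath x y) : qpath_comp (qpath_id y) p = p.
Proof. by apply: val_inj; rewrite /= cats0. Qed.

Lemma qpath_comp1r x y (p : qpath x y) : qpath_comp p (qpath_id x) = p.
Proof. exact: val_inj. Qed.

Lemma qpath_compA x y z t (r : qpath z t) (q : qpath y z) (p : qpath x y) :
  qpath_comp r (qpath_comp q p) = qpath_comp (qpath_comp r q) p.
Proof. by apply: val_inj; rewrite /= catA. Qed.

Lemma kcomp_linearl x y z (f : khom x y) c (g g' : khom y z) :
  kcomp (c *: g + g') f = c *: kcomp g f + kcomp g' f.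
Proof. exact: kextend_linear. Qed.

Lemma kcomp_linearr x y z (g : khom y z) c (f f' : khom x y) :
  kcomp g (c *: f + f') = c *: kcomp g f + kcomp g f'.
Proof.
rewrite /kcomp [kextend _ g]/kextend [in RHS]/kextend.
rewrite scaler_sumr -big_split; apply: eq_bigr => q _ /=.
by rewrite kextend_linear scalerDr !scalerA mulrC.
Qed.

Lemma kcomp1m x y (f : khom x y) : kcomp (kpath (qpath_id y)) f = f.
Proof.
rewrite /kcomp kextend_kpath -[RHS]kextend_id.
by apply: eq_kextend => p; rewrite qpath_comp1.
Qed.

Lemma kcompm1 x y (f : khom x y) : kcomp f (kpath (qpath_id x)) = f.
Proof.
rewrite /kcomp -[RHS]kextend_id.
by apply: eq_kextend => p; rewrite kextend_kpath qpath_comp1r.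
Qed.

Lemma kcompA x y z t (h : khom z t) (g : khom y z) (f : khom x y) :
  kcomp h (kcomp g f) = kcomp (kcomp h g) f.
Proof.
rewrite /kcomp kextend_kextend; apply: eq_kextend => r.
rewrite !kextend_kextend; apply: eq_kextend => q.
rewrite kextend_kextend kextend_kpath; apply: eq_kextend => p.
by rewrite kextend_kpath qpath_compA.
Qed.

Definition path_category : lincat k :=
  @LinCat k (qvert Q) khom (fun x => kpath (qpath_id x)) kcomp
    kcomp1m kcompm1 kcompA kcomp_linearl kcomp_linearr.

End PathCategory.

(* Finite fractional Brauer configurations.  A set with an action of an       *)
(* infinite cyclic group <g> is a set with a permutation, g; P(e) and L(e)    *)
(* are pblock P e and pblock L e.  Finiteness of the classes of P is          *)
(* automatic, as the underlying set is finite.                                *)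

(* The formal sequence L(g^{n-1}.e)...L(g.e)L(e), rightmost term first.       *)
Definition Lseq_of (E : finType) (g : {perm E}) (L : {set {set E}})
    (e : E) (n : nat) : seq {set E} :=
  [seq pblock L ((g ^+ i)%g e) | i <- iota 0 n].

Record fBC := FBC {
  fbc_set :> finType;
  fbc_g : {perm fbc_set};
  fbc_P : {set {set fbc_set}};
  fbc_L : {set {set fbc_set}};
  fbc_d : fbc_set -> nat;
  fbc_partP : partition fbc_P [set: fbc_set];
  fbc_partL : partition fbc_L [set: fbc_set];
  fbc_d_gt0 : forall e, (0 < fbc_d e)%N;
  fbc_f1 : forall e, pblock fbc_L e \subset pblock fbc_P e;
  fbc_f2 : forall e1 e2, pblock fbc_L e1 = pblock fbc_L e2 ->
    pblock fbc_P (fbc_g e1) = pblock fbc_P (fbc_g e2);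
  fbc_f3 : forall e1 e2, e1 \in porbit fbc_g e2 -> fbc_d e1 = fbc_d e2;
  fbc_f4 : forall e1 e2, pblock fbc_P e1 = pblock fbc_P e2 <->
    pblock fbc_P ((fbc_g ^+ fbc_d e1)%g e1) =
    pblock fbc_P ((fbc_g ^+ fbc_d e2)%g e2);
  fbc_f5 : forall e1 e2, pblock fbc_L e1 = pblock fbc_L e2 <->
    pblock fbc_L ((fbc_g ^+ fbc_d e1)%g e1) =
    pblock fbc_L ((fbc_g ^+ fbc_d e2)%g e2);
  fbc_f6 : forall e h,
    let s := Lseq_of fbc_g fbc_L e (fbc_d e) in
    let t := Lseq_of fbc_g fbc_L h (fbc_d h) in
    ~~ (infix s t && (s != t)) }.

Section FBCTheory.
Variable E : fBC.
Implicit Types e h : E.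

Local Notation g := (fbc_g E).
Local Notation d := (@fbc_d E).
Local Notation P := (pblock (fbc_P E)).
Local Notation L := (pblock (fbc_L E)).

(* The standard sequence (g^{n-1}.e, ..., g.e, e), n <= d(e), as (e, n).      *)
Definition stdseq : finType := {e : E & 'I_(d e).+1}.

Implicit Types p q : stdseq.

Definition std e n (le_n : (n <= d e)%N) : stdseq :=
  Tagged (fun e => 'I_(d e).+1) (Ordinal (le_n : (n < (d e).+1)%N)).

Definition sbase p : E := tag p.
Definition slen p : nat := tagged p.

Lemma slen_le p : (slen p <= d (sbase p))%N.
Proof. by rewrite -ltnS; apply: ltn_ord. Qed.

Lemma d_gX e n : d ((g ^+ n)%g e) = d e.
Proof. by apply: fbc_f3; apply: mem_porbit. Qed.

Lemma d_gV e n : d ((g ^- n)%g e) = d e.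
Proof. by rewrite -[in RHS](permKV (g ^+ n)%g e) d_gX. Qed.

Fact lcompl_subproof p :
  (d (sbase p) - slen p <= d ((g ^+ slen p)%g (sbase p)))%N.
Proof. by rewrite d_gX leq_subr. Qed.

Definition lcompl p : stdseq := std (lcompl_subproof p).

Fact rcompl_subproof p : (d (sbase p) - slen p <=
  d ((g ^- (d (sbase p) - slen p))%g (sbase p)))%N.
Proof. by rewrite d_gV leq_subr. Qed.

Definition rcompl p : stdseq := std (rcompl_subproof p).

(* L(p) = L(q), where a trivial sequence has L(()_e) = 1_{P(e)}.              *)
Definition std_eqv p q : bool :=
  if slen p == 0%N then (slen q == 0%N) && (P (sbase p) == P (sbase q))
  else Lseq_of g (fbc_L E) (sbase p) (slen p) ==
       Lseq_of g (fbc_L E) (sbase q) (slen q).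

Definition std_closure (X : {set stdseq}) : {set stdseq} :=
  [set q | [exists p in X, std_eqv q p]].

Definition lcompl_set (X : {set stdseq}) : {set stdseq} :=
  [set lcompl p | p in X].

Definition rcompl_set (X : {set stdseq}) : {set stdseq} :=
  [set rcompl p | p in X].

Definition type_S : Prop := forall p q, std_eqv p q ->
     std_closure (rcompl_set (std_closure [set lcompl p])) =
     std_closure (rcompl_set (std_closure [set lcompl q]))
  \/ std_closure (lcompl_set (std_closure [set rcompl p])) =
     std_closure (lcompl_set (std_closure [set rcompl q])).

Definition type_MS : Prop := forall e, L e = [set e].

Definition fBG_type_S : Prop := type_S /\ forall e, #|P e| = 2%N.

Definition f_degree e : rat := (d e)%:R / #|porbit g e|%:R.

Definition integral_f_degree : Prop := forall e, f_degree e \is a Num.int.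

Definition vertex_type : finType := {x : {set E} | x \in fbc_P E}.
Definition arrow_type : finType := {a : {set E} | a \in fbc_L E}.

Fact vertex_subproof e : P e \in fbc_P E.
Proof. by rewrite pblock_mem // (cover_partition (fbc_partP E)) inE. Qed.

Fact arrow_subproof e : L e \in fbc_L E.
Proof. by rewrite pblock_mem // (cover_partition (fbc_partL E)) inE. Qed.

Definition vertex e : vertex_type := exist _ (P e) (vertex_subproof e).
Definition arrow e : arrow_type := exist _ (L e) (arrow_subproof e).

Fact arrow_inhabited (a : arrow_type) : exists e, e \in sval a.
Proof.
by apply/set0Pn; apply: (partition_neq0 (fbc_partL E) (svalP a)).
Qed.

Definition arrow_elt (a : arrow_type) : E := xchoose (arrow_inhabited a).

Definition fBC_quiver : quiver :=
  @Quiver vertex_type arrow_type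
    (fun a => vertex (arrow_elt a)) (fun a => vertex (g (arrow_elt a))).

Lemma arrow_eltK a : arrow (arrow_elt a) = a.
Proof.
apply: val_inj; apply: (def_pblock (partition_trivIset (fbc_partL E))).
  exact: (svalP a).
exact: (xchooseP (arrow_inhabited a)).
Qed.

Lemma L_arrow_elt e : L (arrow_elt (arrow e)) = L e.
Proof. by have /(congr1 val) := arrow_eltK (arrow e). Qed.

Lemma eq_L_P e h : L e = L h -> P e = P h.
Proof.
move=> eqL; have Pe : e \in P h.
  apply: (subsetP (fbc_f1 h)); rewrite -eqL mem_pblock.
  by rewrite (cover_partition (fbc_partL E)) inE.
exact: (same_pblock (partition_trivIset (fbc_partP E)) Pe).
Qed.

Lemma qsrc_arrow e : qsrc (arrow e : qarr fBC_quiver) = vertex e.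
Proof. by apply: val_inj => /=; apply/eq_L_P/L_arrow_elt. Qed.

Lemma qtgt_arrow e : qtgt (arrow e : qarr fBC_quiver) = vertex (g e).
Proof. by apply: val_inj => /=; apply/fbc_f2/L_arrow_elt. Qed.

(* The path L(g^{n-1}.e)...L(g.e)L(e); it is 1_{P(e)} if n = 0.               *)
Definition arrow_seq e n : seq (qarr fBC_quiver) :=
  [seq arrow ((g ^+ i)%g e) | i <- iota 0 n].

Lemma arrow_seq_path e n :
  @is_qpath fBC_quiver (vertex e) (arrow_seq e n) (vertex ((g ^+ n)%g e)).
Proof.
rewrite /arrow_seq; suff path_m m : @is_qpath fBC_quiver (vertex ((g ^+ m)%g e))
    [seq arrow ((g ^+ i)%g e) | i <- iota m n] (vertex ((g ^+ (m + n))%g e)).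
  by have := path_m 0; rewrite expg0 perm1.
elim: n m => [|n IHn] m; first by rewrite addn0 /= eqxx.
apply/andP; split; first by rewrite qsrc_arrow.
by rewrite qtgt_arrow -permM -expgSr -addSnnS; apply: IHn.
Qed.

(* The two paths of a relation (fR1) are parallel. *)
Lemma fR1_parallel e h m : P e = P h -> (m <= minn (d e) (d h))%N ->
  (forall i, (1 <= i <= m)%N ->
     L ((g ^+ (d e - i))%g e) = L ((g ^+ (d h - i))%g h)) ->
  vertex ((g ^+ (d e - m))%g e) = vertex ((g ^+ (d h - m))%g h).
Proof.
move=> ePh le_m eqL; apply: val_inj => /=; case: m => [|m] in le_m eqL *.
  by rewrite !subn0; apply: (fbc_f4 e h).1.
by apply: eq_L_P; apply: eqL; rewrite leqnn.
Qed.

Section Algebra.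
Variable k : fieldType.

Notation kQ := (path_category k fBC_quiver).

Inductive fBC_relation :
  forall x y : obj kQ, hom kQ x y -> Prop :=
| fR1 (x y : obj kQ) e h (m : nat) (p q : @qpath fBC_quiver x y) :
    x = vertex e -> P e = P h ->
    (m <= minn (d e) (d h))%N ->
    (forall i, (1 <= i <= m)%N ->
       L ((g ^+ (d e - i))%g e) = L ((g ^+ (d h - i))%g h)) ->
    sval p = arrow_seq e (d e - m) -> sval q = arrow_seq h (d h - m) ->
    fBC_relation (kpath k p - kpath k q)
| fR2 (x y : obj kQ) (p : @qpath fBC_quiver x y) :
    let n := size (sval p) in
    (1 < n)%N ->
    \bigcap_(i < n)
      [set (g ^+ (n - i.+1))%g z | z in sval (tnth (in_tuple (sval p)) i)]
      = set0 ->
    fBC_relation (kpath k p)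
| fR3 (x y : obj kQ) e n (p : @qpath fBC_quiver x y) :
    x = vertex e -> (d e < n)%N -> sval p = arrow_seq e n ->
    fBC_relation (kpath k p).

Definition Lambda : lincat k := quotcat fBC_relation.

Definition fBC_algebra : kalg k := oppalg (category_algebra Lambda).

End Algebra.

End FBCTheory.

(* Main.v *)
Require Import Defs.
From mathcomp Require Import all_boot all_algebra.
From HB Require Import structures.
From mathcomp Require Import all_fingroup generic_quotient boolp.

(** An integral f-degree makes g^d(e) fix e, because |G.e| divides d(e).  The
    left and right complements of a standard sequence then coincide, and
    taking the complement, p |-> p^, is an involution of the set of standard
    sequences.  Write S for the relation p == q (same formal sequence) and T
    for its conjugate: p T q when p^ == q^.  Two facts drive the proof.

    - The relation T is exactly what (fR1) imposes on paths.
    - Condition (f7) says that S and T commute (type_S_commute).  So the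
      composite p ~ q of S and T (std_sim) is an equivalence relation, and it
      is invariant under the complement.

    A path survives in Lambda_E only if it is the path of a standard sequence:
    by (fR2) it has the form L(g^{n-1}.e)...L(e), and by (fR3) n <= d(e)
    (path_standard).  Hence A_E is spanned by the elements b_p indexed by
    standard sequences, with b_p = b_q when p ~ q (span_std, std_elt_sim).

    Let t be the linear form on kQ_E with value 1 on the paths of full
    sequences and 0 on the other paths.  A rotation of a full sequence is full,
    again since g^d(e) fixes e, so t(uv) = t(vu).  A relation times any path
    has t-value 0 (full_trace_rel): for (fR3) this is (f6), and for (fR1) it
    follows from the key equivalence (is_full_sim), that L(q) followed by L(p)
    is full if and only if q ~ p^, because the right-hand side depends on p
    only through its class.  Therefore t descends to a symmetric linear form
    tr on A_E, and tr (b_p b_q) is 1 if q ~ p^ and 0 otherwise.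

    Thus the b_p and the b_{p^}, p in a set of representatives of ~, are dual
    bases for the bilinear form tr (a a').  Duality gives at one stroke the
    linear independence of the b_p, the finite dimension, and the isomorphism
    a |-> tr (a _) from A_E to its dual.  Taking the opposite algebra does not
    change these properties.

    Type MS implies type S (type_MS_S), and a fractional Brauer graph of type S
    is of type S by definition, so only type S needs an argument. *)

Set Implicit Arguments.
Unset Strict Implicit.
Unset Printing Implicit Defensive.

Import GRing.Theory Num.Theory.
Local Open Scope ring_scope.

Local Notation hom := Defs.hom.

(** * Symmetric algebras from dual families *)

Section ScalarOf.
Variables (k : fieldType) (V : lmodType k) (f : V -> k).
Hypothesis lin_f : scalar f.

(** The linearity proof is an argument, so that the linear structure below can
    be inferred from the term alone. *)
Definition scalar_of of scalar f : V -> k := f.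

HB.instance Definition _ :=
  GRing.isLinear.Build k V k *%R (scalar_of lin_f) lin_f.

End ScalarOf.

Section DualBases.
Variables (k : fieldType) (A : kalg k) (I : finType) (b b' : I -> A).
Variable tr : A -> k.
Hypothesis tr_lin : scalar tr.
Hypothesis tr_mulC : forall a a', tr (kmul A a a') = tr (kmul A a' a).
Hypothesis span_b : forall a, exists c : I -> k, a = \sum_i c i *: b i.
Hypothesis dual_b : forall i j, tr (kmul A (b i) (b' j)) = (i == j)%:R.

Let coord (a : A) i := tr (kmul A a (b' i)).

Let coord_lin i : scalar (coord^~ i).
Proof. by move=> c a a'; rewrite /coord kmul_linearl tr_lin. Qed.

Let coordE (c : I -> k) i : coord (\sum_j c j *: b j) i = c i.
Proof.
rewrite -[LHS]/(scalar_of (coord_lin i) _) linear_sum (bigD1 i) //=.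
rewrite big1 ?addr0 => [|j ne_ji]; rewrite linearZ /= /scalar_of /coord dual_b.
  by rewrite eqxx mulr1.
by rewrite (negPf ne_ji) mulr0.
Qed.

Let coordK (a : A) : a = \sum_i coord a i *: b i.
Proof.
have [c Da] := span_b a; rewrite [LHS]Da; apply: eq_bigr => i _.
by rewrite Da coordE.
Qed.

(** Duality makes the coefficients in any expression over b equal to the
    coordinates tr (a * b' i), so the spanning family b is a basis. *)
Lemma dual_bases_finite_dimensional : finite_dimensional A.
Proof.
exists #|I|, (fun a => \row_i coord a (enum_val i)); split.
  by move=> c a a'; apply/rowP=> i; rewrite !mxE coord_lin.
exists (fun u : 'rV_#|I| => \sum_i u 0 (enum_rank i) *: b i) => [a | u].
  by rewrite [RHS]coordK; apply: eq_bigr => i _; rewrite mxE enum_rankK.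
by apply/rowP => i; rewrite mxE coordE enum_valK.
Qed.

Let phi_lin a : scalar (fun y => tr (kmul A a y)).
Proof. by move=> c y y'; rewrite kmul_linearr tr_lin. Qed.

(** The bimodule isomorphism is a |-> tr (a * _).  It is injective since the
    coordinates of a are values of this form; it is onto since b'
    represents the coordinate forms of b. *)
Lemma dual_bases_symmetric : symmetric_algebra A.
Proof.
exists (fun a => scalar_of (phi_lin a)).
split=> [c a a' y | a x y z | a a' eq_aa' | f].
- exact: etrans (congr1 tr (kmul_linearl _ _ _ _)) (tr_lin _ _ _).
- rewrite /= /scalar_of -!kmulA tr_mulC; by congr tr; rewrite !kmulA.
- rewrite [a]coordK [RHS]coordK; apply: eq_bigr => i _; congr (_ *: _).
  exact: eq_aa'.
(* As tr is symmetric, b' is dual to b on the other side too. *)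
exists (\sum_i f (b i) *: b' i) => y; rewrite [y]coordK !linear_sum.
apply: eq_bigr => i _; rewrite !linearZ /=; congr (_ * _).
rewrite /scalar_of tr_mulC -[LHS]/(scalar_of (phi_lin (b i)) _) linear_sum.
rewrite (bigD1 i) //= big1 ?addr0 => [|j ne_ji];
  rewrite linearZ /= /scalar_of dual_b.
  by rewrite eqxx mulr1.
by rewrite eq_sym (negPf ne_ji) mulr0.
Qed.

End DualBases.

Section DualFamilies.
Variables (k : fieldType) (A : kalg k) (J : finType) (e : rel J).
Variable b b' : J -> A.
Variable tr : A -> k.
Hypothesis e_refl : reflexive e.
Hypothesis e_sym : symmetric e.
Hypothesis e_trans : transitive e.
Hypothesis tr_lin : scalar tr.
Hypothesis tr_mulC : forall a a', tr (kmul A a a') = tr (kmul A a' a).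
Hypothesis span_b : forall a, exists c : J -> k, a = \sum_j c j *: b j.
Hypothesis eq_b : forall i j, e i j -> b i = b j.
Hypothesis dual_b : forall i j, tr (kmul A (b i) (b' j)) = (e i j)%:R.

Let canon i := odflt i [pick j | e i j].

Let canon_e i : e i (canon i).
Proof. by rewrite /canon; case: pickP => //=. Qed.

Let eq_canon i j : e i j -> canon i = canon j.
Proof.
move=> e_ij; have /eq_pick eq_pick_ij : e i =1 e j.
  by move=> l; apply/idP/idP; apply: e_trans => //; rewrite e_sym.
by rewrite /canon eq_pick_ij; case: pickP => //= /(_ j); rewrite e_refl.
Qed.

Let canonK i : canon (canon i) == canon i.
Proof. by apply/eqP/esym/eq_canon. Qed.

Let I : finType := {i : J | canon i == i}.

(** Allows repetitions in the spanning family, as long as the pairing detects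
    exactly which vectors are repeated: one representative in each class of e
    gives dual bases. *)
Lemma dual_families_symmetric : finite_dimensional A /\ symmetric_algebra A.
Proof.
have span a : exists c : I -> k, a = \sum_i c i *: b (val i).
  have [c ->] := span_b a; exists (fun i => \sum_(j | canon j == val i) c j).
  rewrite (partition_big (fun j => exist _ (canon j) (canonK j) : I) predT) //=.
  apply: eq_bigr => i _; rewrite scaler_suml; apply: eq_big => // j /eqP <-.
  by rewrite (eq_b (canon_e j)).
have dual (i j : I) : tr (kmul A (b (val i)) (b' (val j))) = (i == j)%:R.
  rewrite dual_b; congr (nat_of_bool _)%:R.
  apply/idP/eqP => [e_ij | ->]; last exact: e_refl.
  by apply: val_inj; rewrite -(eqP (valP i)) -(eqP (valP j)); apply: eq_canon.
split; first exact: dual_bases_finite_dimensional tr_lin span dual.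
exact: dual_bases_symmetric tr_lin tr_mulC span dual.
Qed.

End DualFamilies.

(** * Traces on linear categories, their quotients and path categories *)

Section QuotientTrace.
Variables (k : fieldType) (C : lincat k).
Variable R : forall x y, hom C x y -> Prop.
Variable t : forall x, hom C x x -> k.
Hypothesis t_lin : forall x, scalar (@t x).
Hypothesis t_cyc : forall x y (g : hom C y x) (f : hom C x y),
  t (ccomp C g f) = t (ccomp C f g).
Hypothesis t_rel : forall x y (f : hom C x y), R f ->
  forall h : hom C y x, t (ccomp C h f) = 0.

Let t0 x : t (0 : hom C x x) = 0.
Proof. exact: (linear0 (scalar_of (t_lin (x := x)))). Qed.

(** Cyclicity moves every factor multiplied to the right of a relation to its
    left; so it is enough that t vanish on left multiples of relations. *)
Lemma trace_ideal x (f : hom C x x) : ideal_gen R f -> t f = 0.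
Proof.
suff t_comp y z (f' : hom C y z) : ideal_gen R f' ->
    forall h : hom C z y, t (ccomp C h f') = 0.
  by move=> If; rewrite -(comp1m f) t_comp.
elim=> {x f y z f'} [x y f Rf | x y | x y c f f' _ IHf _ IHf' | x y z g f _ IHf
    | x y z f g _ IHf] h.
- exact: t_rel.
- by rewrite compm0 t0.
- by rewrite comp_linearr t_lin IHf IHf' mulr0 addr0.
- by rewrite Defs.compA IHf.
- by rewrite Defs.compA t_cyc Defs.compA IHf.
Qed.

Definition qtrace x (u : hom (quotcat R) x x) : k :=
  t (repr (u : qhom R x x)).

Lemma qtrace_qpi x (f : hom C x x) : qtrace (qpi R f) = t f.
Proof.
apply/eqP; rewrite -subr_eq0; apply/eqP.
have /trace_ideal := repr_qpi R f; rewrite /qtrace.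
rewrite -[_ - f]addrC -scaleN1r t_lin mulN1r addrC; exact.
Qed.

Lemma qtrace_lin x : scalar (@qtrace x).
Proof.
move=> c u v; have [f ->] := qpi_surj u; have [g ->] := qpi_surj v.
by rewrite -qpiZ -qpiD !qtrace_qpi t_lin.
Qed.

Lemma qtrace_cyc x y (g : hom (quotcat R) y x) (f : hom (quotcat R) x y) :
  qtrace (ccomp (quotcat R) g f) = qtrace (ccomp (quotcat R) f g).
Proof.
have [g' ->] := qpi_surj g; have [f' ->] := qpi_surj f.
by rewrite /= !qcompE !qtrace_qpi t_cyc.
Qed.

End QuotientTrace.

Section CategoryTrace.
Variables (k : fieldType) (C : lincat k).
Variable t : forall x, hom C x x -> k.
Hypothesis t_lin : forall x, scalar (@t x).
Hypothesis t_cyc : forall x y (g : hom C y x) (f : hom C x y),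
  t (ccomp C g f) = t (ccomp C f g).

Definition catalg_trace (a : catalg C) : k := \sum_x t (coef a x x).

Lemma catalg_trace_lin : scalar catalg_trace.
Proof.
move=> c a a'; rewrite /catalg_trace mulr_sumr -big_split.
apply: eq_bigr => x _.
by rewrite catalgDE catalgZE t_lin.
Qed.

Lemma catalg_trace_mul a a' : catalg_trace (catalg_mul a a') =
  \sum_x \sum_y t (ccomp C (coef a y x) (coef a' x y)).
Proof.
apply: eq_bigr => x _; rewrite catalgE.
exact: (linear_sum (scalar_of (t_lin (x := x)))).
Qed.

Lemma catalg_trace_mulC a a' :
  catalg_trace (catalg_mul a a') = catalg_trace (catalg_mul a' a).
Proof.
rewrite !catalg_trace_mul exchange_big.
by apply: eq_bigr => x _; apply: eq_bigr => y _; apply: t_cyc.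
Qed.

End CategoryTrace.

Section PathCategory.
Variables (k : fieldType) (Q : quiver).
Notation kQ := (path_category k Q).

Lemma khom_ind (x y : qvert Q) (H : khom k x y -> Prop) :
  H 0 -> (forall c f g, H f -> H g -> H (c *: f + g)) ->
  (forall p, H (kpath k p)) -> forall f, H f.
Proof.
move=> H0 HD Hp f; rewrite -[f]kextend_id /kextend.
by elim/big_rec: _ => // p g _ Hg; apply: HD.
Qed.

Lemma kcomp_kpath (x y z : qvert Q) (q : qpath y z) (p : qpath x y) :
  kcomp (kpath k q) (kpath k p) = kpath k (qpath_comp q p).
Proof. by rewrite /kcomp !kextend_kpath. Qed.

Lemma kcomp0m (x y z : qvert Q) (f : khom k x y) :
  kcomp (0 : khom k y z) f = 0.
Proof. exact: (@comp0m k kQ x y z f). Qed.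

Lemma kcompm0 (x y z : qvert Q) (g : khom k y z) :
  kcomp g (0 : khom k x y) = 0.
Proof. exact: (@compm0 k kQ x y z g). Qed.

(** Total in s and in the end points: this avoids transporting paths along
    equalities of vertices. *)
Definition seq_path (x y : qvert Q) (s : seq (qarr Q)) : khom k x y :=
  if insub s is Some p then kpath k (p : qpath x y) else 0.

Lemma seq_path_val (x y : qvert Q) (p : qpath x y) :
  seq_path x y (sval p) = kpath k p.
Proof. by rewrite /seq_path (_ : sval p = val p) ?valK. Qed.

Lemma seq_path0 (x y : qvert Q) s : ~~ is_qpath x s y -> seq_path x y s = 0.
Proof. by move=> nP; rewrite /seq_path insubN. Qed.

Section Trace.
Variable F : pred (seq (qarr Q)).
Hypothesis F_rot : forall s s', F (s ++ s') = F (s' ++ s).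

Definition path_trace (x : qvert Q) (f : khom k x x) : k :=
  kextend (V := k^o) (fun p => (F (sval p))%:R) f.

Lemma path_traceP (x : qvert Q) c (f g : khom k x x) :
  path_trace (c *: f + g) = c * path_trace f + path_trace g.
Proof. by rewrite /path_trace kextend_linear. Qed.

Lemma path_trace_lin x : scalar (@path_trace x).
Proof. by move=> c f g; apply: path_traceP. Qed.

Lemma path_trace0 (x : qvert Q) : path_trace (0 : khom k x x) = 0.
Proof. by rewrite /path_trace kextend0. Qed.

Lemma path_trace_kpath (x : qvert Q) (p : qpath x x) :
  path_trace (kpath k p) = (F (sval p))%:R.
Proof. by rewrite /path_trace kextend_kpath. Qed.

Lemma path_trace_cyc (x y : qvert Q) (g : khom k y x) (f : khom k x y) :
  path_trace (kcomp g f) = path_trace (kcomp f g).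
Proof.
have lin2 c u v u' v' : path_trace u = path_trace u' ->
    path_trace v = path_trace v' ->
    path_trace (c *: u + v : khom k x x) =
    path_trace (c *: u' + v' : khom k y y).
  by move=> eq_u eq_v; rewrite !path_traceP eq_u eq_v.
elim/khom_ind: g => [|c g g' IHg IHg'|q].
- by rewrite kcomp0m kcompm0 !path_trace0.
- by rewrite (kcomp_linearl f c g g') (kcomp_linearr f c g g'); apply: lin2.
elim/khom_ind: f => [|c f f' IHf IHf'|p].
- by rewrite kcomp0m kcompm0 !path_trace0.
- rewrite (kcomp_linearl (kpath k q) c f f') (kcomp_linearr (kpath k q) c f f').
  exact: lin2.
by rewrite !kcomp_kpath !path_trace_kpath F_rot.
Qed.

Lemma path_trace_seq_path (x y : qvert Q) s s' :
  path_trace (kcomp (seq_path y x s') (seq_path x y s)) =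
  [&& is_qpath x s y, is_qpath y s' x & F (s ++ s')]%:R.
Proof.
have [Ps | nPs] := boolP (is_qpath x s y); last first.
  by rewrite (seq_path0 nPs) kcompm0 path_trace0.
have [Ps' | nPs'] := boolP (is_qpath y s' x); last first.
  by rewrite (seq_path0 nPs') kcomp0m path_trace0.
have -> := seq_path_val (exist _ s Ps).
have -> := seq_path_val (exist _ s' Ps').
by rewrite kcomp_kpath path_trace_kpath.
Qed.

End Trace.
End PathCategory.

(** * Standard sequences and their complements *)

Section StandardSequences.
Variable E : fBC.
Implicit Types (e h : E) (p q r : stdseq E).

Local Notation g := (fbc_g E).
Local Notation d := (@fbc_d E).
Local Notation P := (pblock (fbc_P E)).
Local Notation L := (pblock (fbc_L E)).
Local Notation Q := (fBC_quiver E).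

Lemma mem_L e : e \in L e.
Proof. by rewrite mem_pblock (cover_partition (fbc_partL E)) inE. Qed.

Lemma stdseq_inj p q : sbase p = sbase q -> slen p = slen q -> p = q.
Proof.
case: p q => [e i] [h j]; rewrite /sbase /slen /= => eq_eh.
by case: h / eq_eh j => j /val_inj->.
Qed.

Lemma is_qpath_tgt (x y z : qvert Q) s :
  is_qpath x s y -> is_qpath x s z -> y = z.
Proof.
elim: s x => [|a s IHs] x /=; first by move=> /eqP<- /eqP.
by move=> /andP[_ +] /andP[_]; apply: IHs.
Qed.

Lemma is_qpath_src (x y x' y' : qvert Q) s :
  s != [::] -> is_qpath x s y -> is_qpath x' s y' -> x = x'.
Proof. by case: s => //= a s _ /andP[/eqP<- _] /andP[/eqP<-]. Qed.

Lemma size_arrow_seq e n : size (arrow_seq e n) = n.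
Proof. by rewrite size_map size_iota. Qed.

Lemma nth_arrow_seq a e n i : (i < n)%N ->
  nth a (arrow_seq e n) i = arrow ((g ^+ i)%g e).
Proof. by move=> lt_in; rewrite (nth_map 0%N) ?size_iota // nth_iota. Qed.

Lemma arrow_seqD e m n :
  arrow_seq e (m + n) = arrow_seq e m ++ arrow_seq ((g ^+ m)%g e) n.
Proof.
rewrite /arrow_seq iotaD map_cat add0n; congr (_ ++ _).
rewrite -[in LHS](addn0 m) iotaDl -map_comp; apply: eq_map => i /=.
by rewrite -permM -expgD.
Qed.

Lemma arrow_seq_catP e n s t : arrow_seq e n = s ++ t ->
  [/\ n = (size s + size t)%N, s = arrow_seq e (size s)
    & t = arrow_seq ((g ^+ size s)%g e) (size t)].
Proof.
move=> Dst; have /esym Dn := congr1 size Dst.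
rewrite size_cat size_arrow_seq in Dn.
move: Dst; rewrite -Dn arrow_seqD => /eqP.
by rewrite eqseq_cat ?size_arrow_seq // => /andP[/eqP-> /eqP->].
Qed.

Lemma Lseq_arrow e n : Lseq_of g (fbc_L E) e n = map val (arrow_seq e n).
Proof. by rewrite /arrow_seq -map_comp. Qed.

Definition ssrc p : qvert Q := vertex (sbase p).
Definition stgt p : qvert Q := vertex ((g ^+ slen p)%g (sbase p)).
Definition sarrows p : seq (qarr Q) := arrow_seq (sbase p) (slen p).

Lemma sarrows_path p : is_qpath (ssrc p) (sarrows p) (stgt p).
Proof. exact: arrow_seq_path. Qed.

Lemma size_sarrows p : size (sarrows p) = slen p.
Proof. exact: size_arrow_seq. Qed.

(** The formal sequence of a trivial sequence is a vertex, while its sequence of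
    arrows is empty; comparing source and arrows treats both cases alike. *)
Lemma std_eqvP p q :
  reflect (ssrc p = ssrc q /\ sarrows p = sarrows q) (std_eqv p q).
Proof.
have vertexE e h : (P e == P h) = (vertex e == vertex h) by [].
rewrite /std_eqv; case: (posnP (slen p)) => [p0 | p_gt0].
  rewrite vertexE; apply: (iffP andP) => [[/eqP q0 /eqP eq_x] | [eq_x eq_pq]].
    by rewrite /sarrows p0 q0.
  rewrite -[slen q]size_sarrows -eq_pq size_sarrows p0; split=> //.
  exact/eqP.
rewrite !Lseq_arrow (inj_eq (inj_map val_inj)).
apply: (iffP eqP) => [eq_pq | [_ //]]; split=> //.
have nz_p: sarrows p != [::] by rewrite -size_eq0 size_sarrows -lt0n.
apply: is_qpath_src nz_p (sarrows_path p) _.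
rewrite [sarrows p]eq_pq; exact: sarrows_path.
Qed.

Lemma std_eqv_tgt p q : std_eqv p q -> stgt p = stgt q.
Proof.
move=> /std_eqvP[eq_x eq_s]; apply: is_qpath_tgt (sarrows_path p) _.
by rewrite eq_x eq_s sarrows_path.
Qed.

Lemma std_eqv_refl : reflexive (@std_eqv E).
Proof. by move=> p; apply/std_eqvP. Qed.

Lemma std_eqv_sym : symmetric (@std_eqv E).
Proof. by move=> p q; apply/std_eqvP/std_eqvP => -[-> ->]. Qed.

Lemma std_eqv_trans : transitive (@std_eqv E).
Proof.
move=> q p r /std_eqvP[xpq spq] /std_eqvP[xqr sqr].
by apply/std_eqvP; rewrite xpq spq.
Qed.

Lemma sbase_lcompl p : sbase (lcompl p) = (g ^+ slen p)%g (sbase p).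
Proof. by []. Qed.

Lemma slen_lcompl p : slen (lcompl p) = (d (sbase p) - slen p)%N.
Proof. by []. Qed.

Lemma sbase_rcompl p :
  sbase (rcompl p) = (g ^- (d (sbase p) - slen p))%g (sbase p).
Proof. by []. Qed.

Lemma slen_rcompl p : slen (rcompl p) = (d (sbase p) - slen p)%N.
Proof. by []. Qed.

(** When classes of L are singletons, nontrivial equivalent sequences are equal;
    for a trivial one, the complement is full, hence alone in its class, and
    complementing back gives the trivial sequence at the same vertex. *)
Lemma type_MS_S : type_MS E -> type_S E.
Proof.
move=> ms.
have L_inj e h : L e = L h -> e = h by rewrite !ms => /set1_inj.
have eqv_eq p q : (0 < slen p)%N -> std_eqv q p -> q = p.
  move=> p_gt0 /std_eqvP[_ eq_s]; have := congr1 size eq_s.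
  rewrite !size_sarrows => eq_n; apply: stdseq_inj => //.
  move: eq_s; rewrite /sarrows eq_n -(prednK p_gt0) /arrow_seq /= expg0.
  by rewrite !perm1 => /(congr1 (map val)) /= -[/L_inj].
have closure1 p : (0 < slen p)%N -> std_closure [set p] = [set p].
  move=> p_gt0; apply/setP=> q; rewrite !inE; apply/exists_inP/eqP => [[r]|->].
    by rewrite inE => /eqP-> /eqv_eq->.
  by exists p; rewrite ?inE ?std_eqv_refl.
move=> p q eqv_pq; left; case: (posnP (slen q)) => [q0 | q_gt0]; last first.
  by rewrite (eqv_eq _ _ q_gt0 eqv_pq).
have p0 : slen p = 0%N.
  by have /std_eqvP[_ /(congr1 size)] := eqv_pq; rewrite !size_sarrows q0.
have cK r : slen r = 0%N -> rcompl_set (std_closure [set lcompl r]) = [set r].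
  move=> r0; rewrite closure1; last by rewrite slen_lcompl r0 subn0 fbc_d_gt0.
  rewrite /rcompl_set imset_set1; congr [set _]; apply: stdseq_inj.
    rewrite sbase_rcompl slen_lcompl sbase_lcompl d_gX r0 subn0 subnn.
    by rewrite !perm1 invg1 perm1.
  by rewrite slen_rcompl slen_lcompl sbase_lcompl d_gX r0 subn0 subnn.
rewrite !cK //; apply/setP=> r; rewrite !inE.
apply/exists_inP/exists_inP => -[s]; rewrite inE => /eqP-> eqv_r.
  by exists q; rewrite ?inE //; apply: std_eqv_trans eqv_pq.
by exists p; rewrite ?inE //; apply: std_eqv_trans eqv_r _; rewrite std_eqv_sym.
Qed.

(** The length of the orbit of e divides d e. *)
Lemma integral_period : integral_f_degree E -> forall e, (g ^+ d e)%g e = e.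
Proof.
move=> intE e; have /Num.Theory.intrP[z] := intE e.
have n_gt0 : (0 < #|porbit g e|)%N.
  by apply/card_gt0P; exists e; apply: porbit_id.
rewrite /f_degree => /(canRL (divfK _)).
rewrite pnatr_eq0 -lt0n n_gt0 => /(_ isT).
rewrite !pmulrn -intrM => /intr_inj /(congr1 absz).
rewrite abszM /= => ->; rewrite mulnC expgM permX.
by elim: (absz z) => //= m ->; rewrite permX iter_porbit.
Qed.

(** The symmetrizing form of the algebra is the indicator function of these
    paths. *)
Definition is_full (s : seq (qarr Q)) : bool :=
  [exists e : E, s == arrow_seq e (d e)].

Lemma is_fullP s : reflect (exists e, s = arrow_seq e (d e)) (is_full s).
Proof. by apply: (iffP existsP) => -[e]; exists e; apply/eqP. Qed.

Lemma arrow_seq_full_neq0 e : arrow_seq e (d e) != [::].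
Proof. by rewrite -size_eq0 size_arrow_seq -lt0n fbc_d_gt0. Qed.

(** Otherwise the full sequence at e would be a proper prefix of another full
    sequence, against (f6). *)
Lemma overlong_not_full e n t : (d e < n)%N -> ~~ is_full (arrow_seq e n ++ t).
Proof.
move=> lt_dn; apply/is_fullP => -[h eq_h].
have := fbc_f6 e h; rewrite /= !Lseq_arrow.
rewrite -eq_h -(subnKC (ltnW lt_dn)) arrow_seqD !map_cat -catA.
set s := map _ _; set s' := _ ++ _.
rewrite prefix_infix ?prefix_prefix //= negbK => /eqP/(congr1 size)/eqP.
rewrite /s' !size_cat !size_map !size_iota -[X in X == _]addn0 eqn_add2l.
by rewrite eq_sym addn_eq0 subn_eq0 leqNgt lt_dn.
Qed.

(** * The equivalence of standard sequences *)

Section Periodic.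
Hypothesis period : forall e, (g ^+ d e)%g e = e.

Lemma rcompl_lcompl : @rcompl E =1 @lcompl E.
Proof.
move=> p; apply: stdseq_inj; last by [].
rewrite sbase_rcompl sbase_lcompl; apply: (canLR (permK _)).
by rewrite -permM -expgD subnKC ?slen_le // period.
Qed.

Lemma lcomplK : involutive (@lcompl E).
Proof.
move=> p; apply: stdseq_inj.
  by rewrite !sbase_lcompl slen_lcompl -permM -expgD subnKC ?slen_le // period.
by rewrite !slen_lcompl sbase_lcompl d_gX subKn // slen_le.
Qed.

Lemma ssrc_lcompl p : ssrc (lcompl p) = stgt p.
Proof. by []. Qed.

Lemma stgt_lcompl p : stgt (lcompl p) = ssrc p.
Proof. by rewrite -ssrc_lcompl lcomplK. Qed.

(** The complements of p and q are the final segments that complete them to full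
    sequences; these agree exactly when (fR1) identifies L(p) and L(q). *)
Definition cofinal p q : bool := std_eqv (lcompl p) (lcompl q).

Definition std_sim p q : bool := [exists r, std_eqv p r && cofinal r q].

Lemma std_simP p q :
  reflect (exists2 r, std_eqv p r & cofinal r q) (std_sim p q).
Proof.
by apply: (iffP existsP) => -[r]; [case/andP; exists r | exists r; apply/andP].
Qed.

(** Writing S for std_eqv and T for cofinal, the set [[^p]^] consists of the r
    with p T s and s S r for some s; the two alternatives of (f7) coincide
    here.  From q T r follows r \in [[^q]^], which is [[^p]^] by (f7). *)
Lemma type_S_commute p q r : type_S E ->
  std_eqv p q -> cofinal q r -> exists2 s, cofinal p s & std_eqv s r.
Proof.
move=> tS eqv_pq cof_qr.
have{tS}: std_closure (lcompl_set (std_closure [set lcompl p])) =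
          std_closure (lcompl_set (std_closure [set lcompl q])).
  have cE (X : {set stdseq E}) : rcompl_set X = lcompl_set X.
    exact: eq_imset rcompl_lcompl.
  by have := tS _ _ eqv_pq; rewrite !cE !rcompl_lcompl => -[].
move/setP/(_ r); rewrite !inE.
have -> : [exists x in lcompl_set (std_closure [set lcompl q]), std_eqv r x].
  apply/exists_inP; exists r; last exact: std_eqv_refl.
  rewrite -[r]lcomplK imset_f // inE; apply/exists_inP.
  by exists (lcompl q); rewrite ?inE // std_eqv_sym.
move/exists_inP => [_ /imsetP[x + ->] eqv_r].
rewrite inE => /exists_inP[_ /set1P->].
move=> eqv_x; exists (lcompl x); last by rewrite std_eqv_sym.
by rewrite /cofinal lcomplK std_eqv_sym.
Qed.

(** Cutting a full sequence at e after n terms and exchanging the two pieces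
    gives the full sequence at g^n.e, as g^d(e).e = e. *)
Lemma is_full_rot s t : is_full (s ++ t) = is_full (t ++ s).
Proof.
suff rot s' t' : is_full (s' ++ t') -> is_full (t' ++ s').
  by apply/idP/idP; apply: rot.
move=> /is_fullP[e /esym/arrow_seq_catP[Dd Ds Dt]]; apply/is_fullP.
exists ((g ^+ size s')%g e); rewrite d_gX Dd addnC arrow_seqD -Dt.
by rewrite -permM -expgD -Dd period -Ds.
Qed.

Section Equivalence.
Hypothesis commute : forall p q r,
  std_eqv p q -> cofinal q r -> exists2 s, cofinal p s & std_eqv s r.

Lemma cofinal_refl : reflexive cofinal.
Proof. by move=> p; apply: std_eqv_refl. Qed.

Lemma cofinal_sym : symmetric cofinal.
Proof. by move=> p q; apply: std_eqv_sym. Qed.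

Lemma cofinal_trans : transitive cofinal.
Proof. by move=> q p r; apply: std_eqv_trans. Qed.

Lemma std_sim_refl : reflexive std_sim.
Proof.
move=> p; apply/std_simP.
by exists p; [apply: std_eqv_refl | apply: cofinal_refl].
Qed.

Lemma std_sim_sym : symmetric std_sim.
Proof.
suff sym p q : std_sim p q -> std_sim q p.
  by move=> p q; apply/idP/idP; apply: sym.
move=> /std_simP[r eqv_pr /(commute eqv_pr)[s cof_ps eqv_sq]].
by apply/std_simP; exists s; rewrite 1?std_eqv_sym 1?cofinal_sym.
Qed.

(** Commutation turns the middle cofinal-then-std_eqv step around, bringing the
    composite back to one step of each kind. *)
Lemma std_sim_trans : transitive std_sim.
Proof.
move=> q p r /std_simP[a eqv_pa cof_aq] /std_simP[b eqv_qb cof_br].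
rewrite std_eqv_sym in eqv_qb; rewrite cofinal_sym in cof_aq.
have [x cof_bx eqv_xa] := commute eqv_qb cof_aq.
apply/std_simP; exists x.
  by apply: std_eqv_trans eqv_pa _; rewrite std_eqv_sym.
by apply: cofinal_trans cof_br; rewrite cofinal_sym.
Qed.

(** The complement exchanges std_eqv and cofinal. *)
Lemma std_sim_lcompl p q : std_sim p q -> std_sim (lcompl p) (lcompl q).
Proof.
move=> /std_simP[r eqv_pr cof_rq]; rewrite std_sim_sym; apply/std_simP.
exists (lcompl r); first by rewrite std_eqv_sym.
by rewrite /cofinal !lcomplK std_eqv_sym.
Qed.

Lemma std_sim_ends p q : std_sim p q -> ssrc p = ssrc q /\ stgt p = stgt q.
Proof.
move=> /std_simP[r eqv_pr cof_rq].
have [-> _] := std_eqvP _ _ eqv_pr; have -> := std_eqv_tgt eqv_pr.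
have [] := std_eqvP _ _ cof_rq; rewrite !ssrc_lcompl => -> _.
by have := std_eqv_tgt cof_rq; rewrite !stgt_lcompl.
Qed.

(** If q ~ p^, some r == q is such that r^ == p, and r with r^ is full.
    Conversely a full path L(q) followed by L(p) is cut into a sequence
    equivalent to q and its complement, equivalent to p. *)
Lemma is_full_sim p q : std_sim q (lcompl p) =
  [&& ssrc p == stgt q, stgt p == ssrc q & is_full (sarrows q ++ sarrows p)].
Proof.
apply/idP/and3P
  => [/[dup] /std_sim_ends[xq yq] /std_simP[r eqv_qr] | [/eqP xp /eqP yp]].
  rewrite stgt_lcompl in yq; rewrite /cofinal lcomplK => /std_eqvP[_ <-].
  rewrite yq xq eqxx; split=> //.
  have [_ ->] := std_eqvP _ _ eqv_qr.
  apply/is_fullP; exists (sbase r).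
  by rewrite -[X in arrow_seq _ X](subnKC (slen_le r)) arrow_seqD.
move=> /is_fullP[e /[dup] full_e /esym/arrow_seq_catP[Dd Dq Dp]].
have le_q : (slen q <= d e)%N by rewrite Dd size_sarrows leq_addr.
have Dsrc : ssrc q = vertex e.
  apply: is_qpath_src (arrow_seq_full_neq0 e) _ (arrow_seq_path _ _).
  rewrite -full_e; apply: is_qpath_cat (sarrows_path q) _.
  by rewrite -xp; apply: sarrows_path.
have eqv_q : std_eqv q (std le_q).
  by apply/std_eqvP; split; rewrite // Dq size_sarrows.
apply/std_simP; exists (std le_q) => //; rewrite /cofinal lcomplK.
rewrite std_eqv_sym; apply/std_eqvP; rewrite ssrc_lcompl -(std_eqv_tgt eqv_q).
split=> //; rewrite Dp size_sarrows /sarrows sbase_lcompl slen_lcompl.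
by rewrite {3}/sbase /slen /= Dd !size_sarrows addKn.
Qed.

(** By is_full_sim, the completions of p to full paths depend on the class of p
    only. *)
Lemma is_full_sim_cat p q s : std_sim p q -> is_qpath (stgt p) s (ssrc p) ->
  is_full (sarrows p ++ s) -> is_full (sarrows q ++ s).
Proof.
move=> sim_pq path_s; rewrite is_full_rot => /[dup] full_sp /is_fullP.
move=> [e /[dup] eq_e /esym/arrow_seq_catP[Dd Ds Dp]].
have le_s : (size s <= d e)%N by rewrite Dd leq_addr.
pose r := std le_s; have Dr : sarrows r = s by rewrite [RHS]Ds.
(* If s is empty, only its end points tell where r starts. *)
have path_sp : is_qpath (stgt p) (s ++ sarrows p) (stgt p).
  exact: is_qpath_cat path_s (sarrows_path p).
have xr : stgt p = ssrc r.
  apply: is_qpath_src path_sp _; first by rewrite eq_e arrow_seq_full_neq0.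
  by rewrite eq_e; apply: arrow_seq_path.
have yr : ssrc p = stgt r.
  by apply: is_qpath_tgt path_s _; rewrite xr -Dr sarrows_path.
have : std_sim r (lcompl p) by rewrite is_full_sim xr yr !eqxx Dr.
move/std_sim_trans => /(_ _ (std_sim_lcompl sim_pq)).
by rewrite is_full_sim Dr is_full_rot => /and3P[].
Qed.

End Equivalence.
End Periodic.
End StandardSequences.

(** * The algebra of a fractional Brauer configuration *)

Section FractionalBrauerAlgebra.
Variables (k : fieldType) (E : fBC).
Local Notation g := (fbc_g E).
Local Notation d := (@fbc_d E).
Local Notation Q := (fBC_quiver E).
Local Notation kQ := (path_category k Q).
Local Notation R := (@fBC_relation E k).
Local Notation Lam := (Lambda E k).
Implicit Types (e h : E) (p q r : stdseq E).

Lemma qpi0 (x y : qvert Q) : qpi R (0 : khom k x y) = 0.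
Proof. by have := qpiZ R 0 (0 : khom k x y); rewrite !scale0r. Qed.

Lemma qpi_rel (x y : qvert Q) (f : khom k x y) : R f -> qpi R f = 0.
Proof.
move=> Rf; transitivity (qpi R (0 : khom k x y)).
  by apply/qpiP; rewrite subr0; apply: ideal_gen_rel.
exact: qpi0.
Qed.

Lemma vertex_surj (x : qvert Q) : exists e : E, x = vertex e.
Proof.
case: x => X PX; have /set0Pn[e eX] := partition_neq0 (fbc_partP E) PX.
exists e; apply: val_inj => /=; symmetry.
exact: def_pblock (partition_trivIset (fbc_partP E)) PX eX.
Qed.

Lemma arrow_mem (a : qarr Q) e : e \in sval a -> arrow e = a.
Proof.
move=> ea; apply: val_inj => /=.
exact: def_pblock (partition_trivIset (fbc_partL E)) (svalP a) ea.
Qed.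

(** An element z of the intersection in (fR2) is a common end: e = g^{1-n}.z
    makes the path equal to L(g^{n-1}.e)...L(e), and (fR3) kills it
    if d e < n. *)
Lemma path_standard (x y : qvert Q) (w : qpath x y) : qpi R (kpath k w) != 0 ->
  exists p, sarrows p = sval w /\ ssrc p = x.
Proof.
move=> nz_w; pose n := size (sval w).
case: (posnP n) => [/size0nil w0 | n_gt0].
  have [e Dx] := vertex_surj x; exists (std (leq0n (d e))).
  by rewrite w0 /sarrows /ssrc.
have src_arrow e m : sval w = arrow_seq e m -> vertex e = x.
  move=> Dw; have nz_m : arrow_seq e m != [::] by rewrite -Dw -size_eq0 -lt0n.
  apply: is_qpath_src nz_m (arrow_seq_path e m) _.
  by rewrite -Dw; apply: (svalP w).
(* A path of one arrow escapes (fR2), but its intersection is the arrow. *)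
have [e Dw] : exists e, sval w = arrow_seq e n.
  have /set0Pn[z /bigcapP z_w] : \bigcap_(i < n)
      [set (g ^+ (n - i.+1))%g z | z in sval (tnth (in_tuple (sval w)) i)]
        != set0.
    apply: contra nz_w => /eqP cap0; case: (leqP n 1) => [n_le1 | n_gt1].
      pose a := tnth (in_tuple (sval w)) (Ordinal n_gt0).
      have [e e_w] := arrow_inhabited a.
      suff : e \in (set0 : {set E}) by rewrite inE.
      rewrite -cap0; apply/bigcapP=> i _.
      have i0 : (i : nat) = 0%N.
        by apply/eqP; rewrite -leqn0 -ltnS (leq_trans _ n_le1).
      apply/imsetP; exists e.
        by rewrite (_ : i = Ordinal n_gt0) //; apply: val_inj.
      have n1 : n = 1%N by apply/eqP; rewrite eqn_leq n_le1.
      by rewrite i0 {1}n1 subnn expg0 perm1.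
    by apply/eqP/qpi_rel/fR2.
  exists ((g ^- n.-1)%g z).
  apply: (@eq_from_nth _ (arrow z)); rewrite ?size_arrow_seq //.
  move=> i lt_in; have /imsetP[u u_w Dz] := z_w (Ordinal lt_in) isT.
  rewrite nth_arrow_seq //.
  rewrite (tnth_nth (arrow z)) /= in u_w; rewrite -(arrow_mem u_w); congr arrow.
  have {}Dz : z = (g ^+ (n.-1 - i))%g u by rewrite Dz subnS -predn_sub.
  apply: (@perm_inj _ (g ^+ (n.-1 - i))%g).
  rewrite -Dz -permM -expgD subnKC ?permKV //.
  by rewrite -ltnS prednK.
have [le_nd | lt_dn] := leqP n (d e).
  exists (std le_nd).
  by split; [rewrite /sarrows Dw | rewrite -(src_arrow _ _ Dw)].
case/eqP: nz_w; apply: qpi_rel; apply: (fR3 _ lt_dn Dw).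
by rewrite (src_arrow _ _ Dw).
Qed.

(** The test on x selects the right vertex when p is trivial: its list of
    arrows is empty, hence a path at every vertex. *)
Definition std_path p (x y : qvert Q) : khom k x y :=
  if x == ssrc p then seq_path k x y (sarrows p) else 0.

Definition std_elt p : catalg Lam :=
  @catalg_of k Lam (fun x y : qvert Q => qpi R (std_path p x y)).

Lemma std_path0 p (x y : qvert Q) :
  (x != ssrc p) || (y != stgt p) -> std_path p x y = 0.
Proof.
rewrite /std_path; case: eqP => //= -> ne_y; apply: seq_path0.
by apply: contra ne_y => /(is_qpath_tgt (sarrows_path p))->.
Qed.

Lemma span_hom (x y : qvert Q) (u : qhom R x y) :
  exists c : stdseq E -> k, u = \sum_p c p *: qpi R (std_path p x y).
Proof.
have [f ->] := qpi_surj u; elim/khom_ind: f => [|a f f' [c Df] [c' Df']|w].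
- by exists (fun=> 0); rewrite qpi0 big1 // => p _; rewrite scale0r.
- exists (fun p => a * c p + c' p).
  rewrite qpiD qpiZ Df Df' scaler_sumr -big_split.
  by apply: eq_bigr => p _; rewrite scalerDl scalerA.
have [-> | /path_standard[p [Dw Dx]]] := eqVneq (qpi R (kpath k w)) 0.
  by exists (fun=> 0); rewrite big1 // => p _; rewrite scale0r.
exists (fun q => (q == p)%:R); rewrite (bigD1 p) //= eqxx scale1r.
rewrite big1 ?addr0 => [|q /negPf->]; last by rewrite scale0r.
by rewrite /std_path Dx eqxx Dw seq_path_val.
Qed.

Lemma span_std (a : catalg Lam) :
  exists c : stdseq E -> k, a = \sum_p c p *: std_elt p.
Proof.
have /choice[c Da] (xy : qvert Q * qvert Q) := span_hom (coef a xy.1 xy.2).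
exists (fun p => c (ssrc p, stgt p) p); apply: catalgP => x y.
have coef_sum I (r : seq I) (F : I -> catalg Lam) :
    coef (\sum_(i <- r) F i) x y = \sum_(i <- r) coef (F i) x y.
  apply: (big_morph (fun b => coef b x y)).
    by move=> b b'; apply: catalgDE.
  exact: catalgE.
rewrite coef_sum (Da (x, y)); apply: eq_bigr => p _.
rewrite catalgZE catalgE /=.
have [/std_path0-> | ] := boolP ((x != ssrc p) || (y != stgt p)).
  by rewrite qpi0 !scaler0.
by rewrite negb_or !negbK => /andP[/eqP-> /eqP->].
Qed.

Section Symmetric.
Hypothesis period : forall e, (g ^+ d e)%g e = e.
Hypothesis commute : forall p q r,
  std_eqv p q -> cofinal q r -> exists2 s, cofinal p s & std_eqv s r.

Local Notation full_trace := (path_trace (k := k) (@is_full E)).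

(** This is how (fR1) enters the equivalence of standard sequences. *)
Lemma fR1_sim e h m (le_e : (d e - m <= d e)%N) (le_h : (d h - m <= d h)%N) :
  pblock (fbc_P E) e = pblock (fbc_P E) h -> (m <= minn (d e) (d h))%N ->
  (forall i, (1 <= i <= m)%N -> pblock (fbc_L E) ((g ^+ (d e - i))%g e) =
     pblock (fbc_L E) ((g ^+ (d h - i))%g h)) ->
  cofinal (std le_e) (std le_h).
Proof.
move=> eqP_eh; rewrite leq_min => /andP[le_me le_mh] eqL.
apply/std_eqvP; split.
  by apply: fR1_parallel eqP_eh _ eqL; rewrite leq_min le_me.
rewrite /sarrows !sbase_lcompl !slen_lcompl /sbase /slen /= !subKn //.
rewrite /arrow_seq; apply/eq_in_map => i.
rewrite mem_iota add0n => /andP[_ lt_im].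
have := eqL (m - i)%N; rewrite subn_gt0 lt_im leq_subr => /(_ isT) eqLi.
apply: val_inj; rewrite /= -!permM -!expgD !addnBAC //.
by rewrite -!subnBA ?(ltnW lt_im).
Qed.

(** For (fR1), the two paths come from equivalent standard sequences, so they
    have the same completions to full paths.  A path as in (fR2) cannot occur
    in L(g^{n-1}.e)...L(e), because g^{n-1}.e would be in the intersection. *)
Lemma full_trace_rel (x y : qvert Q) (f : khom k x y) : R f ->
  forall h : khom k y x, full_trace (kcomp h f) = 0.
Proof.
move=> Rf h; elim/khom_ind: h => [|c h h' IHh IHh'|h].
- by rewrite kcomp0m path_trace0.
- rewrite (kcomp_linearl f c h h'); move: (kcomp h f) (kcomp h' f) IHh IHh'.
  by move=> u v Du Dv; rewrite path_traceP Du Dv mulr0 addr0.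
have trE (p : qpath x y) :
    full_trace (kcomp (kpath k h) (kpath k p)) =
    (is_full (sval p ++ sval h))%:R.
  by rewrite kcomp_kpath path_trace_kpath.
case: Rf h trE => {x y f} [x y e e' m p q Dx eqP_ee' le_m eqL Dp Dq
    | x y p n n_gt1 cap0 | x y e n p Dx lt_dn Dp] h trE; last first.
- by rewrite trE Dp (negPf (overlong_not_full _ lt_dn)).
- rewrite trE; case: is_fullP => // -[e /esym/arrow_seq_catP[_ Dp _]].
  have n_gt0 : (0 < n)%N by apply: ltnW.
  suff : (g ^+ n.-1)%g e \in (set0 : {set E}) by rewrite inE.
  rewrite -cap0; apply/bigcapP=> i _; apply/imsetP; exists ((g ^+ i)%g e).
    have Di : nth (arrow e) (sval p) i = arrow ((g ^+ i)%g e).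
      by rewrite [in LHS]Dp nth_arrow_seq.
    by rewrite (tnth_nth (arrow e)) /= Di mem_L.
  rewrite -permM -expgD; congr (fun_of_perm (g ^+ _)%g e).
  have predE n' j : (j < n')%N -> n'.-1 = (j + (n' - j.+1))%N.
    by case: n' => // n' le_jn; rewrite subSS subnKC.
  exact: predE.
have le_e : (d e - m <= d e)%N by apply: leq_subr.
have le_e' : (d e' - m <= d e')%N by apply: leq_subr.
have cof := fR1_sim le_e le_e' eqP_ee' le_m eqL.
have sim1 : std_sim (std le_e) (std le_e').
  by apply/std_simP; exists (std le_e) => //; apply: std_eqv_refl.
have sim2 : std_sim (std le_e') (std le_e) by rewrite std_sim_sym.
have [xe ye] := std_sim_ends period sim1.
have path_p : is_qpath (ssrc (std le_e)) (sarrows (std le_e)) y.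
  by move: (svalP p); rewrite Dp Dx.
have Dy : y = stgt (std le_e) by apply: is_qpath_tgt path_p (sarrows_path _).
have path_h : is_qpath (stgt (std le_e)) (sval h) (ssrc (std le_e)).
  by rewrite -Dy /ssrc -Dx; apply: (svalP h).
suff eq_full : is_full (sval p ++ sval h) = is_full (sval q ++ sval h).
  have -> : kpath k p - kpath k q = (-1) *: kpath k q + kpath k p.
    by rewrite addrC scaleN1r.
  rewrite (kcomp_linearr (kpath k h) (-1) (kpath k q) (kpath k p)).
  have:= trE q; have:= trE p.
  move: (kcomp _ (kpath k q)) (kcomp _ (kpath k p)) => u v Dv Du.
  by rewrite path_traceP Du Dv eq_full mulN1r addNr.
rewrite Dp Dq; apply/idP/idP.
  exact: (is_full_sim_cat period commute sim1 path_h).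
by apply: (is_full_sim_cat period commute sim2); rewrite -xe -ye.
Qed.

Definition Lambda_trace (x : qvert Q) : hom Lam x x -> k :=
  qtrace (C := kQ) (R := R) (fun x => full_trace (x := x)) (x := x).

Let full_lin (x : qvert Q) : scalar (full_trace (x := x)).
Proof. exact: path_trace_lin. Qed.

Let full_cyc (x y : qvert Q) (g' : khom k y x) (f : khom k x y) :
  full_trace (kcomp g' f) = full_trace (kcomp f g').
Proof. by apply: path_trace_cyc; apply: is_full_rot. Qed.

Lemma Lambda_trace_lin x : scalar (Lambda_trace (x := x)).
Proof.
by apply: (qtrace_lin (C := kQ));
  [apply: full_lin | apply: full_cyc | apply: full_trace_rel].
Qed.

Lemma Lambda_trace_cyc (x y : qvert Q) (u : hom Lam y x) (v : hom Lam x y) :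
  Lambda_trace (ccomp Lam u v) = Lambda_trace (ccomp Lam v u).
Proof.
by apply: (qtrace_cyc (C := kQ));
  [apply: full_lin | apply: full_cyc | apply: full_trace_rel].
Qed.

Lemma Lambda_trace_qpi (x : qvert Q) (f : khom k x x) :
  Lambda_trace (qpi R f) = full_trace f.
Proof.
by apply: (qtrace_qpi (C := kQ));
  [apply: full_lin | apply: full_cyc | apply: full_trace_rel].
Qed.

Definition fBC_trace : catalg Lam -> k :=
  catalg_trace (C := Lam) (fun x => Lambda_trace (x := x)).

(** In the double sum over vertices that computes the trace of a product, only
    the end points of p and q contribute. *)
Lemma fBC_trace_std p q :
  fBC_trace (catalg_mul (std_elt p) (std_elt q)) = (std_sim q (lcompl p))%:R.
Proof.
rewrite /fBC_trace catalg_trace_mul; last exact: Lambda_trace_lin.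
have trE (x y : qvert Q) :
    Lambda_trace (ccomp Lam (coef (std_elt p) y x) (coef (std_elt q) x y)) =
    [&& y == ssrc p, x == ssrc q, x == stgt p, y == stgt q
      & is_full (sarrows q ++ sarrows p)]%:R.
  rewrite !catalgE /= qcompE Lambda_trace_qpi /= /std_path.
  case: (y =P ssrc p) => [Dy | _]; last by rewrite kcomp0m path_trace0.
  case: (x =P ssrc q) => [Dx | _]; last by rewrite kcompm0 path_trace0.
  rewrite path_trace_seq_path /= Dx Dy.
  have tgtE r (z : qvert Q) : is_qpath (ssrc r) (sarrows r) z = (z == stgt r).
    apply/idP/eqP => [|->]; last exact: sarrows_path.
    by move=> path_z; apply: is_qpath_tgt path_z (sarrows_path r).
  by rewrite !tgtE andbCA.
rewrite (bigD1 (ssrc q)) //= (bigD1 (ssrc p)) //= trE !eqxx /=.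
rewrite is_full_sim // [X in _ + X + _]big1 => [|y ne_y]; last first.
  by rewrite trE (negPf ne_y).
rewrite big1 => [|x ne_x]; last first.
  by apply: big1 => y _; rewrite trE (negPf ne_x) andbF.
by rewrite !addr0 andbCA (eq_sym (stgt p)).
Qed.

(** The relation (fR1) with m the common length of the complements. *)
Lemma cofinal_rel p q (x y : qvert Q) (w w' : qpath x y) :
  ssrc p = x -> ssrc q = x -> cofinal p q ->
  sval w = sarrows p -> sval w' = sarrows q ->
  qpi R (kpath k w) = qpi R (kpath k w').
Proof.
move=> Dp Dq /std_eqvP[_ eq_s] Dw Dw'; apply/qpiP; apply: ideal_gen_rel.
have len_eq := congr1 size eq_s; rewrite !size_sarrows !slen_lcompl in len_eq.
apply: (@fR1 E k _ _ (sbase p) (sbase q) (d (sbase p) - slen p)).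
- by rewrite -Dp.
- by have /(congr1 val) := etrans Dp (esym Dq).
- by rewrite leq_min leq_subr len_eq leq_subr.
- move=> i /andP[i_gt0 le_im].
  have lt_m : (d (sbase p) - slen p - i < d (sbase p) - slen p)%N.
    by rewrite ltn_subrL i_gt0 (leq_trans i_gt0).
  pose nth_mi s := nth (arrow (sbase p)) s (d (sbase p) - slen p - i).
  have := congr1 nth_mi eq_s; rewrite /nth_mi.
  have addE r : (i <= d (sbase r) - slen r)%N ->
      (slen r + (d (sbase r) - slen r - i) = d (sbase r) - i)%N.
    by move=> le_ir; rewrite addnBA // subnKC ?slen_le.
  rewrite !nth_arrow_seq ?slen_lcompl -?len_eq // !sbase_lcompl -!permM -!expgD.
  by rewrite (addE p) // len_eq (addE q) -?len_eq // => /(congr1 val).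
- by rewrite subKn ?slen_le.
- by rewrite len_eq subKn ?slen_le.
Qed.

(** Equivalence for std_eqv does not change the path; cofinality is (fR1). *)
Lemma std_elt_sim p q : std_sim p q -> std_elt p = std_elt q.
Proof.
move=> sim_pq; have [Dx Dy] := std_sim_ends period sim_pq.
have /std_simP[r eqv_pr cof_rq] := sim_pq; have [xr sr] := std_eqvP _ _ eqv_pr.
apply: catalgP => x y; rewrite !catalgE.
have [nxy | ] := boolP ((x != ssrc p) || (y != stgt p)).
  have -> : std_path p x y = 0 := std_path0 nxy.
  by rewrite Dx Dy in nxy; have -> : std_path q x y = 0 := std_path0 nxy.
rewrite negb_or !negbK => /andP[/eqP-> /eqP->]; rewrite /std_path -Dx eqxx.
have path_p : is_qpath (ssrc p) (sarrows p) (stgt p) by apply: sarrows_path.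
have path_q : is_qpath (ssrc p) (sarrows q) (stgt p).
  by rewrite Dx Dy; apply: sarrows_path.
pose w : qpath (ssrc p) (stgt p) := exist _ (sarrows p) path_p.
pose w' : qpath (ssrc p) (stgt p) := exist _ (sarrows q) path_q.
have -> : seq_path k _ _ (sarrows p) = kpath k w by apply: (seq_path_val k w).
have -> : seq_path k _ _ (sarrows q) = kpath k w' by apply: (seq_path_val k w').
exact: (cofinal_rel (esym xr) (esym Dx) cof_rq).
Qed.

Lemma fBC_algebra_symmetric :
  finite_dimensional (fBC_algebra E k) /\ symmetric_algebra (fBC_algebra E k).
Proof.
apply: (@dual_families_symmetric k (fBC_algebra E k) _ (@std_sim E)
  std_elt (fun p => std_elt (lcompl p)) fBC_trace).
- exact: std_sim_refl.
- exact: std_sim_sym.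
- exact: std_sim_trans.
- by apply: catalg_trace_lin; apply: Lambda_trace_lin.
- move=> a a'; apply: catalg_trace_mulC.
    exact: Lambda_trace_lin.
  exact: Lambda_trace_cyc.
- exact: span_std.
- exact: std_elt_sim.
move=> p q; apply: etrans (fBC_trace_std _ _) _.
by rewrite lcomplK.
Qed.

End Symmetric.
End FractionalBrauerAlgebra.

Theorem proposition5p5 (k : fieldType) (E : fBC)
    (hE : type_S E \/ type_MS E \/ fBG_type_S E)
    (hdeg : integral_f_degree E) :
  finite_dimensional (fBC_algebra E k) /\ symmetric_algebra (fBC_algebra E k).
Proof.
have tS : type_S E by case: hE => [//|[/type_MS_S //|[]]].
have period := integral_period hdeg.
by apply: fBC_algebra_symmetric => // p q r; apply: type_S_commute.
Qed.
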